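(* Consider a pHDAE system of the semi-explicit index-1 form $$\begin{bmatrix} E_{11} & 0 \\ 0 & 0\end{bmatrix}\dot x = \begin{bmatrix} J_{11}-R_{11} & J_{12}-R_{12} \\ -J_{12}^T-R_{12}^T & J_{22}-R_{22}\end{bmatrix}x + \begin{bmatrix} B_1-P_1 \\ B_2-P_2\end{bmatrix}u,\qquad y = \begin{bmatrix} B_1^T+P_1^T & B_2^T+P_2^T\end{bmatrix}x + (S+N)u,$$ with $x(t)\in\mathbb R^n$, $u(t),y(t)\in\mathbb R^m$, where $E_{11}$ and $J_{22}-R_{22}$ are nonsingular. Write $E$, $A=J-R=\begin{bmatrix} A_{11} & A_{12} \\ A_{21} & A_{22}\end{bmatrix}$, $\mathcal B=B-P$, $\mathcal C=(B+P)^T$, $D=S+N$ for its coefficient matrices (so $A_{22}=J_{22}-R_{22}$), and $H(s)=\mathcal C(sE-A)^{-1}\mathcal B+D$ for its transfer function. Let interpolation points $\sigma_1,\dots,\sigma_r\in\mathbb C$ and corresponding tangent directions $b_1,\dots,b_r\in\mathbb C^m$ be given. Define $$V=\begin{bmatrix} V_1 \\ V_2\end{bmatrix}=\left[(\sigma_1E-A)^{-1}\mathcal B b_1,\ \dots,\ (\sigma_rE-A)^{-1}\mathcal B b_r\right]\in\mathbb C^{n\times r}$$ (partitioned conformably with the system), $\mathbb B=[b_1,\dots,b_r]\in\mathbb C^{m\times r}$, and $\mathcal D = D-(B_2^T+P_2^T)(J_{22}-R_{22})^{-1}(B_2-P_2)\in\mathbb C^{m\times m}$. Define the reduced model $$\widehat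 E\dot x_r=(\widehat J-\widehat R) x_r+\widehat{\mathcal B}u,\qquad y_r=\widehat{\mathcal C}x_r+\widehat D u$$ by $$\widehat E=V_1^TE_{11}V_1,\quad \widehat A=V^TAV+\mathbb B^T(\mathcal D-D)\mathbb B,\quad \widehat{\mathcal B}=V^T\mathcal B+\mathbb B^T(B_2^T+P_2^T)A_{22}^{-1}(B_2-P_2),$$ $$\widehat{\mathcal C}=\mathcal C V+(B_2^T+P_2^T)A_{22}^{-1}(B_2-P_2)\mathbb B,\quad \widehat D=\mathcal D=D-(B_2^T+P_2^T)A_{22}^{-1}(B_2-P_2),$$ where $\widehat A=\widehat J-\widehat R$ is the decomposition with $\widehat J=-\widehat J^T$ and $\widehat R=\widehat R^T$. Then the transfer function $\widehat H(s)=\widehat{\mathcal C}(s\widehat E-\widehat A)^{-1}\widehat{\mathcal B}+\widehat D$ of the reduced model matches the polynomial part of $H(s)$ and tangentially interpolates it, i.e., $$H(\sigma_i)b_i=\widehat H(\sigma_i)b_i,\qquad i=1,\dots,r.$$ Moreover, define $\widehat P=\frac12(\widehat{\mathcal C}^T-\widehat{\mathcal B})$ and decompose $\widehat D=\widehat S+\widehat N$ with $\widehat S=\widehat S^T$, $\widehat N=-\widehat N^T$. Then the reduced model is a pHDAE system if the reduced passivity matrix $\widehat W=\begin{bmatrix}\widehat R & \widehat P \\ \widehat P^T & \widehat S\end{bmatrix}$ is positive semidefinite.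
   Context: A linear time-invariant system $E\dot x=(J-R)x+(B-P)u$, $x(t_0)=0$, $y=(B+P)^Tx+(S+N)u$, with $E,J,R\in\mathbb R^{n\times n}$, $B,P\in\mathbb R^{n\times m}$, $S=S^T,\ N=-N^T\in\mathbb R^{m\times m}$, is called a port-Hamiltonian differential-algebraic (pHDAE) system if: (1) $J^T=-J$ and $E=E^T$; (2) $E$ is positive semidefinite; (3) the passivity matrix $W=\begin{bmatrix} R & P \\ P^T & S\end{bmatrix}$ is symmetric positive semidefinite. For the reduced model, the input and output matrices are written as $\widehat{\mathcal B}=\widehat B-\widehat P$ and $\widehat{\mathcal C}=(\widehat B+\widehat P)^T$. In the block form of the claim, the matrices $E,J,R,B,P$ are partitioned conformably: $E=\mathrm{diag}(E_{11},0)$, $J=\begin{bmatrix} J_{11} & J_{12} \\ -J_{12}^T & J_{22}\end{bmatrix}$, $R=\begin{bmatrix} R_{11} & R_{12} \\ R_{12}^T & R_{22}\end{bmatrix}$, $B=\begin{bmatrix} B_1 \\ B_2\end{bmatrix}$, $P=\begin{bmatrix} P_1 \\ P_2\end{bmatrix}$. The polynomial part of a rational matrix function is the polynomial matrix function in its decomposition as a strictly proper rational matrix function plus a polynomial matrix function. The superscript $T$ denotes the transpose.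
   Formalization: Added assumptions: Ê is nonsingular (for matching the polynomial part); σ_iÊ−Â is nonsingular (for interpolation at σ_i); for the pHDAE claim, V and 𝔹 are real, possibly after an invertible change of the reduced state, and the reduced model is formed from these real matrices. *)

(* Defs.v *)
From HB Require Import structures.
From mathcomp Require Import all_boot all_order all_algebra.
From mathcomp Require Import reals.
From mathcomp Require Import complex.
From mathcomp Require Import ring.

Set Implicit Arguments.
Unset Strict Implicit.
Unset Printing Implicit Defensive.

Import Order.TTheory GRing.Theory Num.Theory.
Local Open Scope ring_scope.

Local Notation "p %:F" := (@tofrac _ p) : ring_scope.

(* The system  E x' = A x + B u,  y = C x + D u. *)
Record lti (F : fieldType) (n m : nat) := Lti {
  ltiE : 'M[F]_n;
  ltiA : 'M[F]_n;
  ltiB : 'M[F]_(n, m);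
  ltiC : 'M[F]_(m, n);
  ltiD : 'M[F]_m }.

Definition map_lti (F F' : fieldType) (f : F -> F') (n m : nat)
    (sys : lti F n m) : lti F' n m :=
  Lti (map_mx f (ltiE sys)) (map_mx f (ltiA sys)) (map_mx f (ltiB sys))
      (map_mx f (ltiC sys)) (map_mx f (ltiD sys)).

(* Meaningful only where s E - A is invertible (invmx is the identity on
   singular matrices). *)
Definition transfer (F : fieldType) (n m : nat) (sys : lti F n m) (s : F)
    : 'M[F]_m :=
  ltiC sys *m invmx (s *: ltiE sys - ltiA sys) *m ltiB sys + ltiD sys.

(* The transfer function as a matrix over F(s): the same formula, evaluated at
   the indeterminate s = 'X. *)
Definition transfer_rat (F : fieldType) (n m : nat) (sys : lti F n m)
    : 'M[{fraction {poly F}}]_m :=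
  transfer (map_lti (fun c : F => (c%:P)%:F) sys) ('X : {poly F})%:F.

Definition strictly_proper (F : fieldType) (m : nat)
    (G : 'M[{fraction {poly F}}]_m) : Prop :=
  forall i j, exists p q : {poly F},
    [/\ q != 0, (size p < size q)%N & G i j = p%:F / q%:F].

Definition polynomial_part (F : fieldType) (m : nat)
    (H : 'M[{fraction {poly F}}]_m) (Q : 'M[{poly F}]_m) : Prop :=
  exists2 G, strictly_proper G & H = G + map_mx (@tofrac {poly F}) Q.

Lemma clear_denoms (L : fieldType) (a b c d u v : L) :
  u != 0 -> v != 0 -> c / u + a = d / v + b ->
  (a - b) * (u * v) = d * u - c * v.
Proof.
move=> uN0 vN0 ab; have -> : a - b = d / v - c / u.
  by apply/eqP; rewrite subr_eq addrAC -ab addrAC subrr add0r.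
by rewrite mulrBl (mulrC u) mulrA divfK // (mulrC v) mulrA divfK.
Qed.

Lemma polynomial_part_uniq (F : fieldType) (m : nat)
    (H : 'M[{fraction {poly F}}]_m) (Q1 Q2 : 'M[{poly F}]_m) :
  polynomial_part H Q1 -> polynomial_part H Q2 -> Q1 = Q2.
Proof.
case=> G1 pG1 -> [G2 pG2 e]; apply/matrixP=> i j.
have := congr1 (fun M : 'M_m => M i j) e; rewrite !mxE.
have [p1 [q1 [q1N0 s1 ->]]] := pG1 i j.
have [p2 [q2 [q2N0 s2 ->]]] := pG2 i j.
set x := Q1 i j; set y := Q2 i j => exy.
have exy' : (x - y) * (q1 * q2) = p2 * q1 - p1 * q2.
  apply/eqP; rewrite -tofrac_eq tofracM !tofracB !tofracM; apply/eqP.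
  by apply: clear_denoms; rewrite ?tofrac_eq0.
apply/eqP; rewrite -subr_eq0; apply/negPn/negP=> xyN0.
have qN0 : q1 * q2 != 0 by rewrite mulf_neq0.
have : (size (q1 * q2)%R <= size (p2 * q1 - p1 * q2)%R)%N.
  rewrite -exy'; apply: dvdp_leq; last exact: dvdp_mull.
  by rewrite mulf_neq0.
apply/negP; rewrite -ltnNge.
have bnd (p q p' : {poly F}) : q != 0 -> p' != 0 -> (size p < size q)%N ->
    (size (p * p')%R < size (q * p')%R)%N.
  move=> qn0 p'N0 spq; have [->|pN0] := eqVneq p 0.
    by rewrite mul0r size_poly0 lt0n size_poly_eq0 mulf_neq0.
  rewrite !size_mul //; move: p'N0; rewrite -size_poly_eq0.
  by case: (size p') => // k _; rewrite !addnS /= ltn_add2r.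
apply: leq_ltn_trans (size_polyD _ _) _; rewrite size_polyN gtn_max.
by rewrite {1}(mulrC q1) !bnd.
Qed.

(* The coefficients of  E x' = (J - R) x + (B - P) u,
   y = (B + P)^T x + (S + N) u. *)
Record phsys (F : fieldType) (n m : nat) := PH {
  phE : 'M[F]_n;
  phJ : 'M[F]_n;
  phR : 'M[F]_n;
  phB : 'M[F]_(n, m);
  phP : 'M[F]_(n, m);
  phS : 'M[F]_m;
  phN : 'M[F]_m }.

Definition lti_of_ph (F : fieldType) (n m : nat) (sys : phsys F n m)
    : lti F n m :=
  Lti (phE sys) (phJ sys - phR sys) (phB sys - phP sys)
      (phB sys + phP sys)^T (phS sys + phN sys).

Definition passivity_mx (F : fieldType) (n m : nat) (sys : phsys F n m)
    : 'M[F]_(n + m) :=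
  block_mx (phR sys) (phP sys) (phP sys)^T (phS sys).

(* Symmetry is not included. *)
Definition psdmx (K : realType) (n : nat) (M : 'M[K]_n) : Prop :=
  forall x : 'cV[K]_n, 0 <= (x^T *m M *m x) 0 0.

Definition is_pHDAE (K : realType) (n m : nat) (sys : phsys K n m) : Prop :=
  [/\ (phS sys)^T = phS sys /\ (phN sys)^T = - phN sys,
      (phJ sys)^T = - phJ sys /\ (phE sys)^T = phE sys,
      psdmx (phE sys)
    & (passivity_mx sys)^T = passivity_mx sys /\ psdmx (passivity_mx sys)].

(* J and -R are the skew-symmetric and symmetric parts of A, N and S those of
   D; B and P solve  B - P = (input matrix),  (B + P)^T = (output matrix). *)
Definition ph_of_lti (F : fieldType) (n m : nat) (sys : lti F n m)
    : phsys F n m :=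
  PH (ltiE sys)
     (2^-1 *: (ltiA sys - (ltiA sys)^T))
     (- (2^-1 *: (ltiA sys + (ltiA sys)^T)))
     (2^-1 *: ((ltiC sys)^T + ltiB sys))
     (2^-1 *: ((ltiC sys)^T - ltiB sys))
     (2^-1 *: (ltiD sys + (ltiD sys)^T))
     (2^-1 *: (ltiD sys - (ltiD sys)^T)).

Lemma ph_of_ltiK (K : realType) (n m : nat) (sys : lti K n m) :
  lti_of_ph (ph_of_lti sys) = sys.
Proof.
case: sys => E A B C D; rewrite /lti_of_ph /=; congr Lti.
- by apply/matrixP=> i j; rewrite !mxE; field.
- by apply/matrixP=> i j; rewrite !mxE; field.
- by apply/matrixP=> i j; rewrite !mxE; field.
- by apply/matrixP=> i j; rewrite !mxE; field.
Qed.

Definition interp_basis (F : fieldType) (n m r : nat) (sys : lti F n m)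
    (sigma : 'I_r -> F) (b : 'I_r -> 'cV[F]_m) : 'M[F]_(n, r) :=
  \matrix_(k, j)
    (invmx (sigma j *: ltiE sys - ltiA sys) *m ltiB sys *m b j) k 0.

(* C_2 A_22^-1 B_2, where C_2 and B_2 are the blocks of the output and input
   matrices belonging to the algebraic variables. *)
Definition alg_gain (F : fieldType) (n1 n2 m : nat) (sys : lti F (n1 + n2) m)
    : 'M[F]_m :=
  rsubmx (ltiC sys) *m invmx (drsubmx (ltiA sys)) *m dsubmx (ltiB sys).

(* The Petrov-Galerkin projection by V, with the feedthrough shifted by
   calD - D. All transposes are plain transposes, also over the complex
   numbers. *)
Definition reduce (F : fieldType) (n1 n2 m r : nat) (sys : lti F (n1 + n2) m)
    (V : 'M[F]_(n1 + n2, r)) (BB : 'M[F]_(m, r)) : lti F r m :=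
  let V1 := usubmx V in
  let calD := ltiD sys - alg_gain sys in
  Lti (V1^T *m ulsubmx (ltiE sys) *m V1)
      (V^T *m ltiA sys *m V + BB^T *m (calD - ltiD sys) *m BB)
      (V^T *m ltiB sys + BB^T *m alg_gain sys)
      (ltiC sys *m V + alg_gain sys *m BB)
      calD.

Definition cmx (K : realType) (n m : nat) (M : 'M[K]_(n, m)) : 'M[K[i]]_(n, m) :=
  map_mx (real_complex K) M.

(* (V0, BB0) are V and BB written in real state coordinates x_r = T z. If V and
   BB are real then T = 1 gives V and BB themselves; if the interpolation data
   are closed under conjugation, T passes from pairs of conjugate columns to
   their real and imaginary parts. Without such a T, the matrix V1^T E11 V1 of
   the reduced model need not be real, and even if real it can be negative. *)
Definition real_form (K : realType) (n m r : nat)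
    (V : 'M[K[i]]_(n, r)) (BB : 'M[K[i]]_(m, r)) (T : 'M[K[i]]_r)
    (V0 : 'M[K]_(n, r)) (BB0 : 'M[K]_(m, r)) : Prop :=
  [/\ T \in unitmx, V *m T = cmx V0 & BB *m T = cmx BB0].

(* Main.v *)
(* Eliminating the algebraic variables by a Schur complement turns the index-1
   system into an ODE system with nonsingular leading matrix E11 and feedthrough
   D - C2 A22^-1 B2. For a nonsingular leading matrix, C (s E - A)^-1 B is
   strictly proper (adjugate over characteristic polynomial of E^-1 A), so the
   polynomial part is the feedthrough, which is the one given to the reduced
   model. The resulting shift of the feedthrough is compensated in the other
   reduced matrices so that the i-th unit vector is the reduced state at
   sigma_i under the input b_i, whence tangential interpolation. *)
Require Import Defs.
From HB Require Import structures.
From mathcomp Require Import all_boot all_order all_algebra.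
From mathcomp Require Import reals.
From mathcomp Require Import complex.

Set Implicit Arguments.
Unset Strict Implicit.
Unset Printing Implicit Defensive.

Import Order.TTheory GRing.Theory Num.Theory.
Local Open Scope ring_scope.

(** * Degree bounds and inverses through adjugates *)

Lemma size_det_linear (R : nzRingType) (k : nat) (A : 'M[{poly R}]_k) :
  (forall i j, size (A i j) <= 2)%N -> (size (\det A) <= k.+1)%N.
Proof.
move=> sA; apply: leq_trans (size_sum _ _ _) _; apply/bigmax_leqP=> s _.
rewrite -signr_odd size_Msign; apply: leq_trans (size_poly_prod_leq _ _) _.
(* A product of [k] factors has size at most the sum of the sizes plus 1 minus [k], so it suffices
   that the sizes sum to at most [2k]. *)
rewrite card_ord leq_subLR addnS ltnS addnn -mul2n mulnC.
by rewrite -[X in (X * 2)%N]card_ord -sum_nat_const; apply: leq_sum=> i _.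
Qed.

(** A cofactor is, up to sign, a minor of order [n - 1] with entries of degree at most 1. The
    characteristic polynomial has size [n + 1], so the bound makes the resolvent strictly proper. *)
Lemma size_adj_char_poly_mx (R : nzRingType) (n : nat) (A : 'M[R]_n) i j :
  (size ((\adj (char_poly_mx A)) i j) <= n)%N.
Proof.
rewrite mxE /cofactor -signr_odd size_Msign.
case: n A i j => [|n] A i j; first by case: i.
apply: size_det_linear => k l; rewrite !mxE.
apply: leq_trans (size_polyD _ _) _; rewrite size_polyN geq_max.
rewrite (leq_trans (size_polyC_leq1 _)) // andbT.
by case: eqP; rewrite ?mulr1n ?size_polyX // mulr0n size_poly0.
Qed.

Lemma invmx_mul_scalar (L : fieldType) (n : nat) (U W Wa : 'M[L]_n) (d : L) :
  U \in unitmx -> d != 0 -> W *m Wa = d%:M ->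
  invmx (U *m W) = d^-1 *: (Wa *m invmx U).
Proof.
move=> uU dN0 WWa; have inv : U *m W *m (d^-1 *: (Wa *m invmx U)) = 1%:M.
  rewrite -scalemxAr -mulmxA (mulmxA W) WWa mul_scalar_mx -scalemxAr scalerA.
  by rewrite mulVf // scale1r mulmxV.
have [uUW _] := mulmx1_unit inv.
by rewrite -[RHS](mulKmx uUW) inv mulmx1.
Qed.

(** * Transfer functions over F(s) with nonsingular leading matrix *)

Section TransferRat.

Variable F : fieldType.

Let fracC : {rmorphism F -> {fraction {poly F}}} := @tofrac _ \o polyC.

Lemma map_fracC p q (M : 'M[F]_(p, q)) :
  map_mx fracC M = map_mx (@tofrac _) (map_mx polyC M).
Proof. by rewrite -map_mx_comp. Qed.

(** Factoring [E] out on the left leaves [s - E^-1 A], whose determinant is monic and hence nonzero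
    in F(s). *)
Lemma rat_pencilE n (E A : 'M[F]_n) : E \in unitmx ->
  tofrac 'X *: map_mx fracC E - map_mx fracC A =
  map_mx fracC E *m map_mx (@tofrac _) (char_poly_mx (invmx E *m A)).
Proof.
move=> uE; rewrite !map_fracC -map_mxZ -map_mxB -map_mxM; congr map_mx.
rewrite /char_poly_mx mulmxBr -map_mxM mulmxA mulmxV // mul1mx.
by rewrite mul_mx_scalar.
Qed.

Lemma rat_char_poly_mx_unit n (A : 'M[F]_n) :
  map_mx (@tofrac _) (char_poly_mx A) \in unitmx.
Proof.
by rewrite unitmxE unitfE det_map_mx tofrac_eq0 monic_neq0 // char_poly_monic.
Qed.

Lemma rat_pencil_unit n (E A : 'M[F]_n) : E \in unitmx ->
  tofrac 'X *: map_mx fracC E - map_mx fracC A \in unitmx.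
Proof.
move=> uE; rewrite rat_pencilE // unitmx_mul map_unitmx uE.
exact: rat_char_poly_mx_unit.
Qed.

Lemma polynomial_part_transfer n m (sys : lti F n m) : ltiE sys \in unitmx ->
  polynomial_part (transfer_rat sys) (map_mx polyC (ltiD sys)).
Proof.
case: sys => E A B C D /= uE.
have uE' : map_mx fracC E \in unitmx by rewrite map_unitmx.
exists (map_mx fracC C *m
        invmx (tofrac 'X *: map_mx fracC E - map_mx fracC A) *m
        map_mx fracC B); last by rewrite -map_fracC.
rewrite rat_pencilE //; set M := invmx E *m A; set Z := char_poly_mx M.
have dN0 : tofrac (char_poly M) != 0.
  by rewrite tofrac_eq0 monic_neq0 // char_poly_monic.
have adjZ : map_mx (@tofrac _) Z *m map_mx (@tofrac _) (\adj Z) =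
    (tofrac (char_poly M))%:M.
  by rewrite -map_mxM mul_mx_adj map_scalar_mx.
rewrite (invmx_mul_scalar uE' dN0 adjZ) -map_invmx //.
(* Numerator over the common denominator [char_poly M]. The outer factors are constant, so only the
   adjugate contributes to the degree. *)
move=> i j; pose N : 'M[{poly F}]_m :=
  map_mx polyC C *m \adj Z *m map_mx polyC (invmx E *m B).
exists (N i j).
exists (char_poly M); split.
- by rewrite monic_neq0 // char_poly_monic.
- rewrite size_char_poly ltnS mxE.
  apply: leq_trans (size_sum _ _ _) _; apply/bigmax_leqP=> k _.
  rewrite !mxE mulrC mul_polyC; apply: leq_trans (size_scale_leq _ _) _.
  apply: leq_trans (size_sum _ _ _) _; apply/bigmax_leqP=> l _.
  rewrite !mxE mul_polyC; apply: leq_trans (size_scale_leq _ _) _.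
  have := size_adj_char_poly_mx M l k; rewrite mxE; exact.
rewrite -scalemxAr -scalemxAl mxE mulrC; congr (_ / _).
transitivity (map_mx (@tofrac _) N i j).
  by rewrite /N !map_mxM !map_fracC !mulmxA.
by rewrite mxE.
Qed.

End TransferRat.

(** * Elimination of the algebraic variables *)

Section Schur.

Variables (L : fieldType) (n1 n2 : nat).
Variables (X11 : 'M[L]_n1) (A12 : 'M[L]_(n1, n2)) (A21 : 'M[L]_(n2, n1)).
Variable A22 : 'M[L]_n2.
Hypothesis uA22 : A22 \in unitmx.
Let Sc := X11 + A12 *m invmx A22 *m A21.
Hypothesis uSc : Sc \in unitmx.
(** This is the shape of [s E - A] with [X11 = s E11 - A11]; because of the minus signs its Schur
    complement [Sc] carries a plus. *)
Let X := block_mx X11 (- A12) (- A21) (- A22).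

Let X1 p (B1 : 'M[L]_(n1, p)) (B2 : 'M[L]_(n2, p)) :=
  invmx Sc *m (B1 - A12 *m invmx A22 *m B2).

Lemma schur_solve p (B1 : 'M[L]_(n1, p)) (B2 : 'M[L]_(n2, p)) :
  X *m col_mx (X1 B1 B2) (- invmx A22 *m (A21 *m X1 B1 B2 + B2)) =
  col_mx B1 B2.
Proof.
have SX1 : Sc *m X1 B1 B2 = B1 - A12 *m invmx A22 *m B2 by rewrite mulKVmx.
move: (X1 B1 B2) SX1 => Y; rewrite /Sc => SY.
rewrite mul_block_col; congr col_mx.
  rewrite !mulNmx mulmxN opprK mulmxDr mulmxDr !mulmxA addrA -mulmxDl.
  by rewrite SY subrK.
by rewrite !mulNmx mulmxN opprK mulKVmx // addrA addNr add0r.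
Qed.

Lemma schur_unit : X \in unitmx.
Proof.
(* Solving for the rows of the identity matrix exhibits a right inverse of [X]. *)
have := schur_solve (usubmx 1%:M) (dsubmx 1%:M).
by rewrite vsubmxK => /mulmx1_unit [].
Qed.

Lemma schur_inv p (B1 : 'M[L]_(n1, p)) (B2 : 'M[L]_(n2, p)) :
  invmx X *m col_mx B1 B2 =
  col_mx (X1 B1 B2) (- invmx A22 *m (A21 *m X1 B1 B2 + B2)).
Proof. by rewrite -{1}schur_solve mulKmx // schur_unit. Qed.

End Schur.

(* Elimination of the algebraic variables. *)
Definition schur_lti (F : fieldType) (n1 n2 m : nat)
    (sys : lti F (n1 + n2) m) : lti F n1 m :=
  let iA22 := invmx (drsubmx (ltiA sys)) in
  Lti (ulsubmx (ltiE sys))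
      (ulsubmx (ltiA sys) - ursubmx (ltiA sys) *m iA22 *m dlsubmx (ltiA sys))
      (usubmx (ltiB sys) - ursubmx (ltiA sys) *m iA22 *m dsubmx (ltiB sys))
      (lsubmx (ltiC sys) - rsubmx (ltiC sys) *m iA22 *m dlsubmx (ltiA sys))
      (ltiD sys - alg_gain sys).

Lemma transfer_schur (F : fieldType) (n1 n2 m : nat)
    (sys : lti F (n1 + n2) m) (s : F) :
  ltiE sys = block_mx (ulsubmx (ltiE sys)) 0 0 0 ->
  drsubmx (ltiA sys) \in unitmx ->
  s *: ltiE (schur_lti sys) - ltiA (schur_lti sys) \in unitmx ->
  transfer sys s = transfer (schur_lti sys) s.
Proof.
case: sys => E A B C D /= eE uA22.
(* The pencil of the eliminated system is rearranged into the Schur complement of the full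
   pencil. *)
rewrite /transfer /schur_lti /alg_gain /= opprB addrCA addrC => uSc.
have := schur_inv uA22 uSc (usubmx B) (dsubmx B); rewrite vsubmxK.
have <- : s *: E - A = block_mx (s *: ulsubmx E - ulsubmx A) (- ursubmx A)
                                (- dlsubmx A) (- drsubmx A).
  rewrite {1}eE -{1}(submxK A) scale_block_mx opp_block_mx add_block_mx.
  by rewrite !scaler0 !sub0r.
move=> sol; rewrite -(mulmxA C) sol -{1}(hsubmxK C) mul_row_col.
rewrite -[in RHS]mulmxA.
move: (invmx _ *m (_ - _)) => Z.
rewrite mulNmx mulmxN mulmxDr mulmxDr mulmxBl !mulmxA.
by rewrite opprD !addrA -!addrA [- _ + D]addrC.
Qed.

Lemma map_alg_gain (F F' : fieldType) (f : {rmorphism F -> F'})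
    (n1 n2 m : nat) (sys : lti F (n1 + n2) m) :
  alg_gain (map_lti f sys) = map_mx f (alg_gain sys).
Proof.
by rewrite /alg_gain /= !map_mxM map_invmx map_rsubmx map_drsubmx map_dsubmx.
Qed.

Lemma map_schur_lti (F F' : fieldType) (f : {rmorphism F -> F'})
    (n1 n2 m : nat) (sys : lti F (n1 + n2) m) :
  schur_lti (map_lti f sys) = map_lti f (schur_lti sys).
Proof.
rewrite /schur_lti map_alg_gain /map_lti /=.
by rewrite !map_mxB !map_mxM map_invmx map_ulsubmx map_ulsubmx map_ursubmx
  map_dlsubmx map_drsubmx map_usubmx map_dsubmx map_lsubmx map_rsubmx.
Qed.

Lemma polynomial_part_transfer_index1 (F : fieldType) (n1 n2 m : nat)
    (sys : lti F (n1 + n2) m) :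
  ltiE sys = block_mx (ulsubmx (ltiE sys)) 0 0 0 ->
  ulsubmx (ltiE sys) \in unitmx -> drsubmx (ltiA sys) \in unitmx ->
  polynomial_part (transfer_rat sys) (map_mx polyC (ltiD sys - alg_gain sys)).
Proof.
move=> eE uE uA.
suff -> : transfer_rat sys = transfer_rat (schur_lti sys).
  exact: (polynomial_part_transfer (sys := schur_lti sys)).
pose f : {rmorphism F -> {fraction {poly F}}} := @tofrac _ \o polyC.
(* Elimination is applied over F(s) at [s = 'X], where the eliminated pencil is invertible because
   [E11] is. *)
rewrite /transfer_rat -[fun c => _]/(f : _ -> _) transfer_schur.
- by rewrite map_schur_lti.
- by rewrite /= {1}eE map_block_mx !map_mx0 map_ulsubmx.
- by rewrite /= -map_drsubmx map_unitmx.
- by rewrite map_schur_lti; apply: rat_pencil_unit.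
Qed.

(** * Tangential interpolation *)

Lemma usubmx_mulmx_diag (F : fieldType) (n1 n2 r : nat)
    (E : 'M[F]_(n1 + n2)) (V : 'M[F]_(n1 + n2, r)) :
  E = block_mx (ulsubmx E) 0 0 0 ->
  (usubmx V)^T *m ulsubmx E *m usubmx V = V^T *m E *m V.
Proof.
(* Only the differential rows of [V] meet a nonzero block of [E], so the reduced leading matrix is a
   congruence of the whole [E]. *)
move=> eE; rewrite [in RHS]eE -{3 4}(vsubmxK V) tr_col_mx mul_row_block.
by rewrite mul_row_col !mulmx0 !addr0 mul0mx addr0.
Qed.

(* The column [e_i] solves the reduced equation
   [(sigma_i Er - Ar) e_i = Br b_i]: the shifts of [Ar] and [Br] cancel. *)
Lemma transfer_reduce (F : fieldType) (n1 n2 m r : nat)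
    (sys : lti F (n1 + n2) m) (sigma : 'I_r -> F) (b : 'I_r -> 'cV[F]_m)
    (i : 'I_r) :
  let red := reduce sys (interp_basis sys sigma b)
                    (\matrix_(k < m, j < r) b j k 0) in
  ltiE sys = block_mx (ulsubmx (ltiE sys)) 0 0 0 ->
  sigma i *: ltiE sys - ltiA sys \in unitmx ->
  sigma i *: ltiE red - ltiA red \in unitmx ->
  transfer sys (sigma i) *m b i = transfer red (sigma i) *m b i.
Proof.
set V := interp_basis _ _ _; set BB := \matrix_(k, j) _; move=> red eE uX uXr.
pose e : 'cV[F]_r := delta_mx i 0.
have VeE : V *m e =
    invmx (sigma i *: ltiE sys - ltiA sys) *m ltiB sys *m b i.
  by rewrite -colE; apply/matrixP=> k j; rewrite !mxE ord1.
have BBe : BB *m e = b i.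
  by rewrite -colE; apply/matrixP=> k j; rewrite !mxE ord1.
have sol : (sigma i *: ltiE red - ltiA red) *m e = ltiB red *m b i.
  rewrite /red /= usubmx_mulmx_diag // !mulmxBl !mulmxDl.
  rewrite addrAC subrr sub0r mulmxN !mulNmx -!mulmxA BBe opprD opprK addrA.
  congr (_ + _); rewrite -scalemxAl -!mulmxA VeE.
  rewrite scalemxAr -mulmxBr -(mulmxA (invmx _)) scalemxAl -mulmxBl.
  by rewrite mulKVmx.
have trE : transfer red (sigma i) *m b i = ltiC red *m e + ltiD red *m b i.
  by rewrite /transfer mulmxDl -!mulmxA -sol mulKmx.
(* The gain added to the output matrix, applied to [BB *m e = b i], cancels the gain subtracted from
   the feedthrough. *)
rewrite trE /red /= !mulmxDl -(mulmxA _ V) VeE -(mulmxA _ BB) BBe mulNmx.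
by rewrite addrACA subrr addr0 !mulmxA.
Qed.

(** * Port-Hamiltonian structure of the reduced model *)

Lemma is_pHDAE_ph_of_lti (K : realType) (n m : nat) (sys : lti K n m) :
  (ltiE sys)^T = ltiE sys -> psdmx (ltiE sys) ->
  psdmx (passivity_mx (ph_of_lti sys)) -> is_pHDAE (ph_of_lti sys).
Proof.
(* The remaining symmetry conditions hold by construction, as the coefficients are symmetric and
   skew-symmetric parts. *)
move=> sE pE pW; split=> //=.
- by split; apply/matrixP=> i j; rewrite !mxE -?mulrN ?opprB // addrC.
- by split=> //; apply/matrixP=> i j; rewrite !mxE -mulrN opprB.
- split=> //; rewrite /passivity_mx tr_block_mx trmxK; congr block_mx.
  + by apply/matrixP=> i j; rewrite !mxE addrC.
  + by apply/matrixP=> i j; rewrite !mxE addrC.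
Qed.

Lemma psdmx_congr (K : realType) (n r : nat) (M : 'M[K]_n) (V : 'M[K]_(n, r)) :
  psdmx M -> psdmx (V^T *m M *m V).
Proof.
by move=> pM x; have := pM (V *m x); rewrite trmx_mul !mulmxA.
Qed.

Theorem theorem1 (K : realType) (n1 n2 m r : nat)
    (E11 J11 R11 : 'M[K]_n1) (J12 R12 : 'M[K]_(n1, n2)) (J22 R22 : 'M[K]_n2)
    (B1 P1 : 'M[K]_(n1, m)) (B2 P2 : 'M[K]_(n2, m)) (S N : 'M[K]_m)
    (sigma : 'I_r -> K[i]) (b : 'I_r -> 'cV[K[i]]_m) :
  let sys := PH (block_mx E11 0 0 0)
                (block_mx J11 J12 (- J12^T) J22)
                (block_mx R11 R12 R12^T R22)
                (col_mx B1 B2) (col_mx P1 P2) S N in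
  let G := map_lti (real_complex K) (lti_of_ph sys) in
  let V := interp_basis G sigma b in
  let BB := \matrix_(k < m, j < r) b j k 0 in
  let Gr := reduce G V BB in
  is_pHDAE sys ->
  E11 \in unitmx ->
  J22 - R22 \in unitmx ->
  (forall i, sigma i *: ltiE G - ltiA G \in unitmx) ->
  [/\ ltiE Gr \in unitmx ->
        exists Q : 'M[{poly K[i]}]_m,
          polynomial_part (transfer_rat G) Q /\
          polynomial_part (transfer_rat Gr) Q,
      forall i, sigma i *: ltiE Gr - ltiA Gr \in unitmx ->
        transfer G (sigma i) *m b i = transfer Gr (sigma i) *m b i
    & forall T (V0 : 'M[K]_(n1 + n2, r)) (BB0 : 'M[K]_(m, r)),
        real_form V BB T V0 BB0 ->
        let phr := ph_of_lti (reduce (lti_of_ph sys) V0 BB0) in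
        psdmx (passivity_mx phr) -> is_pHDAE phr].
Proof.
move=> sys G V BB Gr phS uE11 uA22 uX.
have eE : ltiE G = block_mx (ulsubmx (ltiE G)) 0 0 0.
  by rewrite /G /= map_block_mx !map_mx0 block_mxKul.
have uE : ulsubmx (ltiE G) \in unitmx.
  by rewrite /G /= map_block_mx block_mxKul map_unitmx.
have uA : drsubmx (ltiA G) \in unitmx.
  by rewrite /G /= opp_block_mx add_block_mx map_block_mx block_mxKdr map_unitmx.
split.
(* The common polynomial part is constant: for [G] by elimination, for [Gr] as its own
   feedthrough. *)
- move=> uEr; exists (map_mx polyC (ltiD G - alg_gain G)); split.
    exact: polynomial_part_transfer_index1.
  exact: (polynomial_part_transfer (sys := Gr)).
- by move=> i; apply: transfer_reduce.
move=> T V0 BB0 _ phr pW; case: phS => _ [_ sE] pE _.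
have E0 : ltiE (lti_of_ph sys) = block_mx (ulsubmx (ltiE (lti_of_ph sys))) 0 0 0.
  by rewrite /= block_mxKul.
apply: is_pHDAE_ph_of_lti => //=.
(* Symmetry and semidefiniteness of [E] pass to the real congruence by [V0]. *)
- by rewrite (usubmx_mulmx_diag _ E0) !trmx_mul trmxK sE mulmxA.
- by rewrite (usubmx_mulmx_diag _ E0); apply: psdmx_congr.
Qed.
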